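(* Let $m,R>0$. Let $f:\overline{B}(0,R)\to\mathbb{R}$ be a continuous function on the closed ball of radius $R$ centred at the origin of $\mathbb{R}^3$, and let $\omega_0\in\mathfrak{so}_3\setminus\{0\}$. Let $(\rho,\theta,y)$ be cylindrical coordinates on $\mathbb{R}^3$ whose axis is the kernel (rotation axis) of $\omega_0$. Then, as $\beta\omega^2\to\infty$ with $\beta>0$ and $\omega\in\mathbb{R}\omega_0$, $$\int_{B(0,R)} f\,\mathrm{d}\nu_{\beta,\omega}\ \longrightarrow\ \int_{\{\rho=R\}\times\mathbb{S}^1\times\{y=0\}} f\,\frac{\mathrm{d}\theta}{2\pi}=\frac{1}{2\pi}\int_0^{2\pi} f(R,\theta,0)\,\mathrm{d}\theta ,$$ i.e. the limit is the average of $f$ over the great circle of radius $R$ in the rotation plane of $\omega_0$.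
   Context: $\mathfrak{so}_3$ is the Lie algebra of skew-symmetric real $3\times3$ matrices, with the inner product $\langle A,B\rangle=-\tfrac12\operatorname{tr}(AB)$, and $\omega^2:=\langle\omega,\omega\rangle$ (so $|\omega\cdot q|^2=\omega^2|q|^2$ for $q$ in the rotation plane of $\omega$). $B(0,R)\subset\mathbb{R}^3$ is the open ball of radius $R$. Cylindrical coordinates $(\rho,\theta,y)$: $y$ is the coordinate along the axis, $\rho\ge0$ the distance to the axis, $\theta\in\mathbb{S}^1$ the angle. For $\beta>0$ and $\omega\in\mathfrak{so}_3$, $\nu_{\beta,\omega}$ is the probability measure on $B(0,R)$ $$\nu_{\beta,\omega}=\frac{e^{\frac12\beta m|\omega\cdot q|^2}\,|\mathrm{d}^3q|}{Z_{\mathrm{rot}}},\qquad Z_{\mathrm{rot}}=\int_{B(0,R)}e^{\frac12\beta m|\omega\cdot q|^2}\,|\mathrm{d}^3q| .$$ *)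

(* Defs.v *)
From HB Require Import structures.
From mathcomp Require Import all_boot all_order all_algebra.
From mathcomp Require Import all_classical all_reals all_analysis.
From mathcomp Require Import measurable_realfun.
From mathcomp Require Import lra.

Set Implicit Arguments.
Unset Strict Implicit.
Unset Printing Implicit Defensive.

Import Order.TTheory GRing.Theory Num.Theory.
Import numFieldNormedType.Exports.

Local Open Scope classical_set_scope.
Local Open Scope ring_scope.

Definition measure_col_display : measure_display -> measure_display.
Proof. exact. Qed.

(* The Borel sigma-algebra of R^n, as generated by the coordinate functions
   (the convention of the library for tuples). *)
Section measurable_col.
Context (R : realType) (n : nat).

Let coor : 'I_n -> 'cV[R]_n -> measurableTypeR R := fun i q => q i 0.

Let col_set0 : g_sigma_preimage coor set0.
Proof. exact: sigma_algebra0. Qed.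

Let col_setC A : g_sigma_preimage coor A -> g_sigma_preimage coor (~` A).
Proof. exact: sigma_algebraC. Qed.

Let col_bigcup (F : _^nat) : (forall i, g_sigma_preimage coor (F i)) ->
  g_sigma_preimage coor (\bigcup_i (F i)).
Proof. exact: sigma_algebra_bigcup. Qed.

HB.instance Definition _ :=
  @isMeasurable.Build (measure_col_display R.-ocitv.-measurable.-sigma)
    'cV[R]_n (g_sigma_preimage coor) col_set0 col_setC col_bigcup.

End measurable_col.

Section lebesgue3.
Context {R : realType}.

Lemma measurable_coor n (i : 'I_n) :
  measurable_fun [set: 'cV[R]_n] (fun q : 'cV[R]_n => q i 0).
Proof.
move=> _ Y mY; rewrite setTI; apply: sub_sigma_algebra => /=.
rewrite -bigcup_seq/=; exists i => /=; first by rewrite mem_index_enum.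
by exists Y => //; rewrite setTI.
Qed.

Lemma measurable_fun_colP d (T : measurableType d) n (f : T -> 'cV[R]_n) :
  measurable_fun [set: T] f <->
  forall i, measurable_fun [set: T] (fun t => f t i 0).
Proof.
split=> [mf i|mf]; first exact: measurableT_comp (measurable_coor i) mf.
have : g_sigma_preimage (fun i t => f t i 0 : measurableTypeR R) `<=` measurable.
  apply: smallest_sub; first exact: sigma_algebra_measurable.
  rewrite -bigcup_seq/= => A [i _ [B mB <-]]; exact: mf.
rewrite (@g_sigma_preimage_comp _ (measurableTypeR R) n 'cV[R]_n
  (fun i q => q i 0) _ f) => prefS _ A mA.
by apply: prefS; exists A.
Qed.

Definition cart (p : R * R * R) : 'cV[R]_3 :=
  \col_(i < 3) [:: p.1.1; p.1.2; p.2]`_i.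

Lemma measurable_cart : measurable_fun
  [set: measurableTypeR R * measurableTypeR R * measurableTypeR R] cart.
Proof.
apply/measurable_fun_colP => i; rewrite /cart.
have -> : (fun t : R * R * R => (\col_(i < 3) [:: t.1.1; t.1.2; t.2]`_i) i 0) =
  (fun t => [:: t.1.1; t.1.2; t.2]`_i) by apply/funext => t; rewrite mxE.
case: i => [[|[|[|//]]] /= _].
- exact: measurableT_comp measurable_fst measurable_fst.
- exact: measurableT_comp measurable_snd measurable_fst.
- exact: measurable_snd.
Qed.

Definition lebesgue3 : set 'cV[R]_3 -> \bar R :=
  pushforward ((lebesgue_measure \x lebesgue_measure) \x lebesgue_measure)%E
    (cart : measurableTypeR R * measurableTypeR R * measurableTypeR R -> _).

Let lebesgue3_0 : lebesgue3 set0 = 0%E.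
Proof. by rewrite /lebesgue3 /pushforward preimage_set0 measure0. Qed.

Let lebesgue3_ge0 A : (0 <= lebesgue3 A)%E.
Proof. by rewrite /lebesgue3 /pushforward measure_ge0. Qed.

Let lebesgue3_sigma_additive : semi_sigma_additive lebesgue3.
Proof.
have mcart A : measurable A -> measurable (cart @^-1` A :
    set (measurableTypeR R * measurableTypeR R * measurableTypeR R)).
  by move=> mA; rewrite -[X in measurable X]setTI; exact: measurable_cart.
move=> F mF tF mUF; rewrite /lebesgue3 /pushforward preimage_bigcup.
apply: measure_semi_sigma_additive => [n||]; first exact: mcart.
- apply/trivIsetP => /= i j _ _ ij; rewrite -preimage_setI.
  by move/trivIsetP : tF => /(_ _ _ _ _ ij) ->//; rewrite preimage_set0.
- by rewrite -preimage_bigcup; exact: mcart.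
Qed.

HB.instance Definition _ := isMeasure.Build _ _ _ lebesgue3
  lebesgue3_0 lebesgue3_ge0 lebesgue3_sigma_additive.

Lemma measurable_box (a b : R) :
  measurable [set q : 'cV[R]_3 | forall i, a < q i 0 < b].
Proof.
have -> : [set q : 'cV[R]_3 | forall i, a < q i 0 < b] =
    \bigcap_(i in [set: 'I_3]) ((fun q : 'cV[R]_3 => q i 0) @^-1` `]a, b[).
  apply/seteqP; split => q /= h i; first by rewrite /= in_itv/= h.
  by move: (h i I); rewrite /= in_itv.
apply: fin_bigcap_measurable => // i _.
by rewrite -[X in measurable X]setTI; exact: measurable_coor.
Qed.

Lemma lebesgue3_box (a b : R) : a < b ->
  lebesgue3 [set q | forall i, a < q i 0 < b] = ((b - a) ^+ 3)%:E.
Proof.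
move=> ab; rewrite /lebesgue3 /pushforward.
have -> : cart @^-1` [set q | forall i, a < q i 0 < b] =
    (`]a, b[ `*` `]a, b[) `*` `]a, b[.
  apply/seteqP; split => [p /= h|p /= [[]]]; rewrite ?in_itv/=.
    by move: (h 0) (h 1) (h ord_max); rewrite !mxE.
  move=> h0 h1 h2 [[|[|[|//]]] ?]; by rewrite mxE.
rewrite [LHS]product_measure1E//; last exact: measurableX.
rewrite [X in (X * _)%E]product_measure1E//.
have E : lebesgue_measure (`]a, b[ : set (measurableTypeR R)) = (b - a)%:E.
  by rewrite lebesgue_measure_itv/= lte_fin ab.
transitivity ((b - a)%:E * (b - a)%:E * (b - a)%:E)%E.
  by congr (_ * _ * _)%E; exact: E.
by rewrite -!EFinM !exprS expr0 mulr1 mulrA.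
Qed.

End lebesgue3.

Section rotating_gas.
Context {R : realType}.
Implicit Types (q : 'cV[R]_3) (w : 'M[R]_3) (m r beta : R).

(* The Euclidean norm; the norm of the library on matrices is the sup norm. *)
Definition enorm q : R := Num.sqrt (\sum_i q i 0 ^+ 2).

Definition eball r : set 'cV[R]_3 := [set q | enorm q < r].

Definition closed_eball r : set 'cV[R]_3 := [set q | enorm q <= r].

Definition so3 : set 'M[R]_3 := [set w | w^T = - w].

Definition so3_inner (A B : 'M[R]_3) : R := - (2^-1 * \tr (A *m B)).

Definition boltzmann m beta w q : R :=
  expR (2^-1 * beta * m * enorm (w *m q) ^+ 2).

Definition Zrot m r beta w : R :=
  \int[lebesgue3]_(q in eball r) boltzmann m beta w q.

(* A measure on the whole of R^3, carried by [eball r]. *)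
Definition nu m r beta w : set 'cV[R]_3 -> \bar R := fun A =>
  (\int[lebesgue3]_(q in A `&` eball r)
    (boltzmann m beta w q / Zrot m r beta w)%:E)%E.

Lemma measurable_enorm : measurable_fun [set: 'cV[R]_3] enorm.
Proof.
apply: (measurableT_comp (continuous_measurable_fun (@sqrt_continuous R))).
by apply: measurable_sum => i; apply: measurable_funX; exact: measurable_coor.
Qed.

Lemma measurable_eball r : measurable (eball r).
Proof.
have -> : eball r = enorm @^-1` `]-oo, r[.
  by apply/seteqP; split => q; rewrite /eball /= in_itv.
by rewrite -[X in measurable X]setTI; exact: measurable_enorm.
Qed.

Lemma measurable_boltzmann m beta w :
  measurable_fun [set: 'cV[R]_3] (boltzmann m beta w).
Proof.
apply: measurableT_comp => //; apply: measurable_funM => //.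
apply: measurable_funX; apply: measurableT_comp measurable_enorm _.
apply/measurable_fun_colP => i.
have -> : (fun q => (w *m q) i 0) = (fun q => \sum_j w i j * q j 0).
  by apply/funext => q; rewrite mxE.
apply: measurable_sum => j; apply: measurable_funM => //.
exact: measurable_coor.
Qed.

Lemma Zrot_ge0 m r beta w : 0 <= Zrot m r beta w.
Proof. by apply: Rintegral_ge0 => q _; exact: expR_ge0. Qed.

Section nu_measure.
Variables (m r beta : R) (w : 'M[R]_3).

Let dens_ge0 q : (0 <= (boltzmann m beta w q / Zrot m r beta w)%:E)%E.
Proof. by rewrite lee_fin divr_ge0 ?expR_ge0 ?Zrot_ge0. Qed.

Let nu0 : nu m r beta w set0 = 0%E.
Proof. by rewrite /nu set0I integral_set0. Qed.

Let nu_ge0 A : (0 <= nu m r beta w A)%E.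
Proof. by apply: integral_ge0 => q _; exact: dens_ge0. Qed.

Let nu_sigma_additive : semi_sigma_additive (nu m r beta w).
Proof.
move=> F mF tF mUF; rewrite /nu setI_bigcupl ge0_integral_bigcup//.
- by apply: is_cvg_ereal_nneg_natsum_cond => n _ _; exact: nu_ge0.
- by move=> n; apply: measurableI => //; exact: measurable_eball.
- apply/measurable_EFinP; apply: measurable_funTS; apply: measurable_funM => //.
  exact: measurable_boltzmann.
- exact: trivIset_setIr.
Qed.

HB.instance Definition _ := isMeasure.Build _ _ _ (nu m r beta w)
  nu0 nu_ge0 nu_sigma_additive.

End nu_measure.

Lemma enorm_ge0 q : 0 <= enorm q. Proof. exact: sqrtr_ge0. Qed.

Lemma enorm_sqr q : enorm q ^+ 2 = \sum_i q i 0 ^+ 2.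
Proof. by rewrite sqr_sqrtr// sumr_ge0// => i _; exact: sqr_ge0. Qed.

Lemma coor_le_enorm q i : `|q i 0| <= enorm q.
Proof.
rewrite -(@ler_pXn2r _ 2)// ?nnegrE ?enorm_ge0// enorm_sqr real_normK ?num_real//.
by rewrite (bigD1 i)//= lerDl sumr_ge0// => j _; exact: sqr_ge0.
Qed.

Lemma eball_finite r : (lebesgue3 (eball r) < +oo)%E.
Proof.
have [r0|r0] := ltP 0 r; last first.
  have -> : eball r = set0.
    apply/seteqP; split => // q; rewrite /eball/= => /lt_le_trans /(_ r0).
    by rewrite ltNge enorm_ge0.
  by rewrite measure0 ltry.
have rr : - r < r by rewrite gtrN.
apply: (@le_lt_trans _ _ (lebesgue3 [set q | forall i, - r < q i 0 < r])).
  apply: le_measure; rewrite ?inE.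
  - exact: measurable_eball.
  - exact: measurable_box.
  - move=> q /= qr i; rewrite -ltr_norml.
    exact: le_lt_trans (coor_le_enorm q i) qr.
by rewrite lebesgue3_box// ltry.
Qed.

Lemma eball_gt0 r : 0 < r -> (0 < lebesgue3 (eball r))%E.
Proof.
move=> r0; have r20 : 0 < r / 2 by rewrite divr_gt0.
apply: (@lt_le_trans _ _ (lebesgue3 [set q | forall i, 0 < q i 0 < r / 2])).
  by rewrite lebesgue3_box// lte_fin subr0 exprn_gt0.
apply: le_measure; rewrite ?inE.
- exact: measurable_box.
- exact: measurable_eball.
- move=> q /= h; rewrite /eball/= -(@ltr_pXn2r _ 2)// ?nnegrE ?enorm_ge0 ?(ltW r0)//.
  have sq i : q i 0 ^+ 2 <= (r / 2) ^+ 2.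
    by case/andP: (h i) => h1 h2; rewrite ler_pXn2r// ?nnegrE ltW.
  rewrite enorm_sqr; apply: (@le_lt_trans _ _ (\sum_(i < 3) (r / 2) ^+ 2)).
    by apply: ler_sum => i _; exact: sq.
  by have := exprn_gt0 2 r0; rewrite sumr_const card_ord -mulr_natr; lra.
Qed.

Lemma boltzmann_bound m r beta w :
  exists2 K : R, 0 < K & forall q, eball r q -> K^-1 <= boltzmann m beta w q <= K.
Proof.
pose S := \sum_i (\sum_j `|w i j| * r) ^+ 2.
pose K := expR (`|2^-1 * beta * m| * S).
exists K; first exact: expR_gt0.
move=> q /= qr; rewrite /K -expRN /boltzmann !ler_expR -ler_norml normrM.
rewrite ler_wpM2l// ger0_norm ?sqr_ge0// enorm_sqr ler_sum// => i _.
rewrite -real_normK ?num_real// ler_pXn2r ?nnegrE//; last first.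
  by rewrite sumr_ge0// => j _; rewrite mulr_ge0// (le_trans _ (ltW qr))// enorm_ge0.
rewrite mxE (le_trans (ler_norm_sum _ _ _))// ler_sum// => j _.
by rewrite normrM ler_wpM2l// (le_trans (coor_le_enorm q j))// ltW.
Qed.

Lemma integral_boltzmannE m r beta w : 0 < r -> 0 < Zrot m r beta w /\
  (\int[lebesgue3]_(q in eball r) (boltzmann m beta w q)%:E)%E =
    (Zrot m r beta w)%:E.
Proof.
move=> r0; have [K K0 bK] := boltzmann_bound m r beta w.
have mb : measurable_fun (eball r) (EFin \o boltzmann m beta w).
  by apply/measurable_EFinP; apply: measurable_funTS; exact: measurable_boltzmann.
have mB := measurable_eball r.
have fin : (\int[lebesgue3]_(q in eball r) (boltzmann m beta w q)%:E < +oo)%E.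
  apply: (@le_lt_trans _ _ (\int[lebesgue3]_(q in eball r) (cst K%:E) q)%E).
    apply: ge0_le_integral => //.
    - by move=> q _; rewrite lee_fin expR_ge0.
    - by move=> q qr; rewrite lee_fin; case/andP: (bK q qr).
  by rewrite integral_cst// lte_mul_pinfty ?lee_fin ?(ltW K0) ?eball_finite.
have pos : (0 < \int[lebesgue3]_(q in eball r) (boltzmann m beta w q)%:E)%E.
  apply: (@lt_le_trans _ _ (\int[lebesgue3]_(q in eball r) (cst K^-1%:E) q)%E).
    by rewrite integral_cst// mule_gt0 ?lte_fin ?invr_gt0// eball_gt0.
  apply: ge0_le_integral => //.
  - by move=> q _; rewrite lee_fin invr_ge0 ltW.
  - by move=> q qr; rewrite lee_fin; case/andP: (bK q qr).
split; first by rewrite /Zrot /Rintegral fine_gt0// pos.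
by rewrite /Zrot /Rintegral fineK// ge0_fin_numE// ltW.
Qed.

Lemma nu_setT m r beta w : 0 < r -> nu m r beta w [set: 'cV[R]_3] = 1%E.
Proof.
move=> r0; have [Z0 ZE] := integral_boltzmannE m beta w r0.
rewrite /nu setTI; under eq_integral do rewrite mulrC EFinM.
rewrite ge0_integralZl_EFin//=.
- by rewrite ZE -EFinM mulVf// gt_eqF.
- exact: measurable_eball.
- by move=> q _; rewrite lee_fin expR_ge0.
- by apply/measurable_EFinP; apply: measurable_funTS; exact: measurable_boltzmann.
- by rewrite invr_ge0 ltW.
Qed.

Lemma so3_inner_gt0 w : so3 w -> w != 0 -> 0 < so3_inner w w.
Proof.
move=> sw w0; rewrite /so3_inner -mulrN mulr_gt0 ?invr_gt0//.
have -> : - \tr (w *m w) = \sum_i \sum_j w i j ^+ 2.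
  rewrite -raddfN/= -mulmxN -sw; apply: eq_bigr => i _.
  by rewrite mxE; apply: eq_bigr => j _; rewrite mxE expr2.
rewrite lt0r; apply/andP; split; last first.
  by rewrite sumr_ge0// => i _; rewrite sumr_ge0// => j _; exact: sqr_ge0.
apply: contra w0 => /eqP/psumr_eq0P h; apply/eqP/matrixP => i j; rewrite mxE.
have /psumr_eq0P h1 : \sum_j w i j ^+ 2 = 0.
  by apply: h => // k _; rewrite sumr_ge0// => l _; exact: sqr_ge0.
by apply/eqP; rewrite -sqrf_eq0; apply/eqP; apply: h1 => // k _; exact: sqr_ge0.
Qed.

(* Along this filter [p = (beta, w)] has [beta > 0] and [w] in the line [R w0],
   and [beta * <w, w>] tends to infinity. *)
Definition fast_rotation (w0 : 'M[R]_3) : set_system (R * 'M[R]_3) :=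
  filter_from [set: R] (fun M => [set p |
    [/\ 0 < p.1, exists t : R, p.2 = t *: w0 & M < p.1 * so3_inner p.2 p.2]]).

Lemma fast_rotation_proper w0 : so3 w0 -> w0 != 0 ->
  ProperFilter (fast_rotation w0).
Proof.
move=> sw w00; have c0 := so3_inner_gt0 sw w00; apply: filter_from_proper.
  apply: filter_from_filter; first by exists 0.
  move=> M N _ _; exists (Num.max M N) => // p [p0 pw].
  by rewrite gt_max => /andP[MB NB]; split.
move=> M _; exists ((`|M| + 1) / so3_inner w0 w0, w0); split => /=.
- by rewrite divr_gt0// ltr_wpDl.
- by exists 1; rewrite scale1r.
- by rewrite divfK ?gt_eqF// (le_lt_trans (ler_norm M))// ltrDl.
Qed.

(* [P] is orthogonal and its last column spans the kernel of [w0]. *)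
Definition axis_frame (w0 P : 'M[R]_3) : Prop :=
  P^T *m P = 1%:M /\
  forall q, w0 *m q = 0 <-> exists y : R, q = y *: col ord_max P.

Definition cylindrical (P : 'M[R]_3) (rho theta y : R) : 'cV[R]_3 :=
  P *m cart (rho * cos theta, rho * sin theta, y).

Definition great_circle_average (P : 'M[R]_3) (r : R) (f : 'cV[R]_3 -> R) :
    \bar R :=
  ((2 * pi)^-1%:E *
    \int[lebesgue_measure]_(theta in `[0%R, (2 * pi)%R])
      (f (cylindrical P r theta 0))%:E)%E.

End rotating_gas.

(* Main.v *)
Require Import Defs.
From HB Require Import structures.
From mathcomp Require Import all_boot all_order all_algebra.
From mathcomp Require Import all_classical all_reals all_analysis.
From mathcomp Require Import measurable_realfun ring lra.

(* Since [w] is a multiple of [w0], the density of [nu] at [q] depends only on the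
   distance [rho] of [q] to the axis, being proportional to
   [exp (beta m |w|^2 rho^2 / 2)].  So [nu] is invariant under the rotations about
   the axis, and by Fubini [f] may be replaced by its mean over these rotations.
   At [q], this mean is the average of [f] over the horizontal circle through [q],
   hence, by uniform continuity of [f], close to the average over the great circle
   as soon as [rho] is close to [r] (in the ball this also forces [y] to be close
   to [0]).  Finally [nu] gives mass [O(exp (- kappa beta |w|^2))] to the points
   with [rho <= r - eta], by comparison with a small ball near the great circle. *)

Set Implicit Arguments.
Unset Strict Implicit.
Unset Printing Implicit Defensive.

Import Order.TTheory GRing.Theory Num.Theory.
Import numFieldNormedType.Exports.
Local Open Scope classical_set_scope.
Local Open Scope ring_scope.

(** * Measure-preserving maps and translations *)

Lemma measurable_preimage d1 d2 (T1 : measurableType d1) (T2 : measurableType d2)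
  (f : T1 -> T2) (A : set T2) : measurable_fun setT f -> measurable A ->
  measurable (f @^-1` A).
Proof. by move=> mf mA; rewrite -[X in measurable X]setTI; exact: mf. Qed.

Section measure_preserving.
Context {R : realType}.

Definition preserves d (T : measurableType d) (mu : {measure set T -> \bar R})
    (f : T -> T) :=
  measurable_fun setT f /\
  forall A, measurable A -> mu (f @^-1` A) = mu A.

Lemma ge0_integral_preserves d (T : measurableType d)
    (mu : {measure set T -> \bar R}) (f : T -> T) (D : set T) (g : T -> \bar R) :
  preserves mu f -> measurable D -> measurable_fun D g ->
  (forall x, D x -> 0 <= g x)%E ->
  (\int[mu]_(x in f @^-1` D) g (f x) = \int[mu]_(x in D) g x)%E.
Proof.
move=> [mf fE] mD mg g0.
rewrite -[LHS](@ge0_integral_pushforward _ _ _ _ _ _ mf mu D g)//; last first.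
  by move=> y /[!inE]; exact: g0.
by apply: eq_measure_integral => //= A mA _; exact: fE.
Qed.

(** The section at [x] of the preimage of [A] is the [f2]-preimage of the section of [A] at [f1 x].
    Invariance of [m2] removes [f2] inside the integral over [m1], and invariance of [m1] then
    removes [f1]. *)
Lemma product_preserves d1 d2 (T1 : measurableType d1) (T2 : measurableType d2)
    (m1 : {measure set T1 -> \bar R}) (m2 : {sigma_finite_measure set T2 -> \bar R})
    (f1 : T1 -> T1) (f2 : T2 -> T2) :
  preserves m1 f1 -> preserves m2 f2 ->
  preserves (m1 \x m2)%E (fun x => (f1 x.1, f2 x.2)).
Proof.
move=> p1 [mf2 f2E]; have [mf1 _] := p1; split.
  by apply/measurable_fun_pair => /=; apply: measurableT_comp.
move=> A mA; rewrite /product_measure1/=.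
transitivity (\int[m1]_x ((m2 \o xsection A) (f1 x)))%E; last first.
  apply: (@ge0_integral_preserves _ _ _ _ setT (m2 \o xsection A) p1) => //.
  exact: measurable_fun_xsection.
apply: eq_integral => x _ /=.
rewrite -(f2E (xsection A (f1 x))); last exact: measurable_xsection.
by congr (m2 _); apply/seteqP; split => y; rewrite /xsection/preimage/= !inE.
Qed.

End measure_preserving.

Section translation.
Context {R : realType}.
Local Notation RR := (measurableTypeR R).
Local Notation leb := (@lebesgue_measure R).
Local Notation V := 'cV[R]_3.

(** Lebesgue measure is determined by its values on half-open intervals, and the preimage of such an
    interval under a translation is another one of the same length. *)
Lemma lebesgue_measure_translate (a : R) :
  preserves leb (fun x : RR => (a + x : RR)).
Proof.
split; first exact: measurable_funD.
move=> A mA; pose T (x : RR) : RR := a + x.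
change (pushforward leb T A = leb A).
apply/esym/lebesgue_measure_unique => //; first exact: measurable_funD.
move=> /= mT _ [[b c] _ <-].
rewrite /= /pushforward.
have -> : T @^-1` `]b, c] = `]b - a, c - a]%classic.
  by apply/seteqP; split => x /=; rewrite !in_itv/= ltrBlDl lerBrDl.
rewrite !lebesgue_measure_itv/= !lte_fin ltrD2r.
by case: ifPn => // _; congr EFin; ring.
Qed.

Lemma lebesgue3_translate (v : V) (A : set V) : measurable A ->
  lebesgue3 ((fun q => v + q) @^-1` A) = lebesgue3 A.
Proof.
move=> mA; rewrite /lebesgue3 /pushforward.
have [_ H] := product_preserves (product_preserves
  (lebesgue_measure_translate (v 0 0)) (lebesgue_measure_translate (v 1 0)))
  (lebesgue_measure_translate (v ord_max 0)).
rewrite -(H ((@cart R) @^-1` A)); last first.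
  by rewrite -[X in measurable X]setTI; exact: measurable_cart.
congr ((_ \x _)%E _); apply: funext => x /=; congr A.
apply/matrixP => i j; rewrite !mxE (ord1 j).
by case: i => [[|[|[|//]]] /= ?]; congr (v _ _ + _); apply/val_inj.
Qed.

End translation.

(** * Invariance of Lebesgue measure under orthogonal maps *)

Section lebesgue3_isometry.
Context {R : realType}.
Local Notation RR := (measurableTypeR R).
Local Notation leb := (@lebesgue_measure R).
Local Notation V := 'cV[R]_3.

(** The balls of integer radius exhaust the space. Sigma-finiteness is what Tonelli requires on the
    product of [lebesgue3] with itself. *)
Lemma lebesgue3_sigma_finite : sigma_finite [set: V] (@lebesgue3 R).
Proof.
exists (fun n => eball n%:R).
  apply/seteqP; split => // q _.
  exists (Num.trunc (enorm q)).+1 => //; rewrite /eball/=.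
  exact: truncnS_gt.
by move=> n; split; [exact: measurable_eball|exact: eball_finite].
Qed.

HB.instance Definition _ := Measure_isSigmaFinite.Build _ _ _ (@lebesgue3 R)
  lebesgue3_sigma_finite.

Lemma measurable_mulmx (Q : 'M[R]_3) : measurable_fun setT (fun q : V => Q *m q).
Proof.
apply/measurable_fun_colP => i.
have -> : (fun q : V => (Q *m q) i 0) = (fun q : V => \sum_j Q i j * q j 0).
  by apply/funext => q; rewrite mxE.
apply: measurable_sum => j; apply: measurable_funM => //.
exact: measurable_coor.
Qed.

Lemma enorm_sqrE (q : V) : enorm q ^+ 2 = (q^T *m q) 0 0.
Proof. by rewrite enorm_sqr mxE; apply: eq_bigr => i _; rewrite mxE expr2. Qed.

Lemma enorm_orthogonal (Q : 'M[R]_3) (q : V) : Q^T *m Q = 1%:M ->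
  enorm (Q *m q) = enorm q.
Proof.
move=> QQ; apply/eqP; rewrite -(@eqrXn2 _ 2) ?enorm_ge0// !enorm_sqrE.
by rewrite trmx_mul -mulmxA [Q^T *m _]mulmxA QQ mul1mx.
Qed.

Lemma enormN (q : V) : enorm (- q) = enorm q.
Proof.
apply/eqP; rewrite -(@eqrXn2 _ 2) ?enorm_ge0//.
by rewrite !enorm_sqr; apply/eqP/eq_bigr => i _; rewrite mxE sqrrN.
Qed.

(* Both sides times [mu B] are the measure of
   [{(x, y) | Q x \in A, y - Q x \in B}] and of [{(x, y) | x \in B, Q x + y \in A}],
   whose sections at fixed [y] are translates of one another. *)
Lemma translation_invariant_orthogonal (mu : {sigma_finite_measure set V -> \bar R})
    (Q : 'M[R]_3) (A B : set V) :
    (forall (v : V) (C : set V), measurable C -> mu ((fun q => v + q) @^-1` C) = mu C) ->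
    Q^T *m Q = 1%:M -> measurable A -> measurable B ->
    (forall x, B (- (Q *m x)) <-> B x) -> (0 < mu B < +oo)%E ->
  mu (mulmx Q @^-1` A) = mu A.
Proof.
move=> mu_transl QQ mA mB BQ /andP[B0 Bf].
have QQ' : Q *m Q^T = 1%:M by apply: mulmx1C.
have mQ1 : measurable_fun setT (fun z : V * V => Q *m z.1).
  exact: measurableT_comp (measurable_mulmx Q) measurable_fst.
have mcoor i (f : V * V -> V) : measurable_fun setT f ->
    measurable_fun setT (fun z => f z i 0).
  by move=> /measurable_fun_colP.
pose S := [set z : V * V | A (Q *m z.1) /\ B (z.2 - Q *m z.1)].
pose S' := [set z : V * V | B z.1 /\ A (Q *m z.1 + z.2)].
have mS : measurable S.
  apply: measurableI; first exact: measurable_preimage mQ1 mA.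
  apply: (@measurable_preimage _ _ _ _ (fun z : V * V => z.2 - Q *m z.1) B) => //.
  apply/measurable_fun_colP => i.
  under eq_fun do rewrite mxE [X in _ + X]mxE.
  by apply: measurable_funB; [exact: (mcoor _ snd)|exact: mcoor].
have mS' : measurable S'.
  apply: measurableI; first exact: measurable_preimage measurable_fst mB.
  apply: (@measurable_preimage _ _ _ _ (fun z : V * V => Q *m z.1 + z.2) A) => //.
  apply/measurable_fun_colP => i.
  under eq_fun do rewrite mxE.
  by apply: measurable_funD; [exact: mcoor|exact: (mcoor _ snd)].
have mQA := measurable_preimage (measurable_mulmx Q) mA.
have integral_cst_indic (a : \bar R) (C : set V) : (0 <= a)%E -> measurable C ->
    (\int[mu]_x (a * (\1_C x)%:E) = a * mu C)%E.
  move=> a0 mC; rewrite ge0_integralZl//; first by rewrite integral_indic// setIT.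
  exact/measurable_EFinP/measurable_indic.
have ES : (\int[mu]_x (mu (xsection S x)) = mu B * mu (mulmx Q @^-1` A))%E.
  rewrite -integral_cst_indic//; apply: eq_integral => x _; rewrite indicE.
  have [xA|xA] := boolP (_ \in _).
    rewrite mule1 -(mu_transl (- (Q *m x)) _ mB); congr (mu _).
    rewrite inE /= in xA.
    apply/seteqP; split => y /=; rewrite /xsection/= inE /S/= addrC; first by case.
    by split.
  rewrite mule0 -(measure0 mu); congr (mu _).
  rewrite notin_setE /= in xA.
  by apply/seteqP; split => y //=; rewrite /xsection/= inE /S/= => -[].
have ES' : (\int[mu]_x (mu (xsection S' x)) = mu A * mu B)%E.
  rewrite -integral_cst_indic//; apply: eq_integral => x _; rewrite indicE.
  have [xB|xB] := boolP (_ \in _).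
    rewrite mule1 -(mu_transl (Q *m x) _ mA); congr (mu _).
    rewrite inE /= in xB.
    by apply/seteqP; split => y /=; rewrite /xsection/= inE /S'/=; [case|split].
  rewrite mule0 -(measure0 mu); congr (mu _).
  rewrite notin_setE /= in xB.
  by apply/seteqP; split => y //=; rewrite /xsection/= inE /S'/= => -[].
(* Replacing [x] by [Q^T *m y + x] turns the two conditions of [S] into [A (y + Q x)] and
   [B (- (Q x))], and the latter is [B x] by the symmetry of [B]. *)
have EY y : mu (ysection S y) = mu (ysection S' y).
  rewrite -(mu_transl (Q^T *m y)); last exact: measurable_ysection.
  congr (mu _); apply/seteqP; split => x /=; rewrite /ysection/= !inE /S/= /S'/=;
    rewrite mulmxDr mulmxA QQ' mul1mx opprD addrA subrr sub0r addrC;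
    by move=> [? ?]; split => //; apply/BQ.
have E : (\int[mu]_x (mu (xsection S x)) = \int[mu]_x (mu (xsection S' x)))%E.
  have := indic_fubini_tonelli mu mu mS.
  rewrite (indic_fubini_tonelli_FE mu mS) (indic_fubini_tonelli_GE mu mS) => ->.
  have := indic_fubini_tonelli mu mu mS'.
  rewrite (indic_fubini_tonelli_FE mu mS') (indic_fubini_tonelli_GE mu mS') => ->.
  by apply: eq_integral => y _; exact: EY.
(* As [mu B] is positive and finite, it can be cancelled. *)
have Bfin : mu B \is a fin_num by rewrite ge0_fin_numE// ltW.
move: E; rewrite ES ES' (muleC (mu A)) => E.
by apply/le_anti/andP; split; rewrite -(lee_pmul2l Bfin B0) E.
Qed.

(** The unit ball serves as the test set [B]: it is stable under [Q] and under negation, and has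
    positive finite measure. No determinant enters. *)
Lemma lebesgue3_orthogonal (Q : 'M[R]_3) (A : set V) : Q^T *m Q = 1%:M ->
  measurable A -> lebesgue3 (mulmx Q @^-1` A) = lebesgue3 A.
Proof.
move=> QQ mA; apply: (@translation_invariant_orthogonal _ Q A (eball 1)) => //.
- by move=> v C; exact: lebesgue3_translate.
- exact: measurable_eball.
- by move=> x; rewrite /eball/= enormN enorm_orthogonal.
- by rewrite eball_gt0// eball_finite.
Qed.

End lebesgue3_isometry.

(** * Density and concentration of the rotating Gibbs measure *)

Section rotating_gas_estimates.
Context {R : realType}.
Local Notation V := 'cV[R]_3.

Lemma sum3 (Z : nmodType) (F : 'I_3 -> Z) : \sum_i F i = F 0 + F 1 + F ord_max.
Proof.
rewrite !big_ord_recr big_ord0/= add0r; congr (F _ + F _ + F _); exact/val_inj.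
Qed.

(* The squared distance to the axis of the frame [P]. *)
Definition rho2 (P : 'M[R]_3) (q : V) : R :=
  (P^T *m q) 0 0 ^+ 2 + (P^T *m q) 1 0 ^+ 2.

Lemma measurable_rho2 P : measurable_fun setT (rho2 P).
Proof.
have mc i : measurable_fun setT (fun q : V => (P^T *m q) i 0).
  by move: i; apply/measurable_fun_colP; exact: measurable_mulmx.
by apply: measurable_funD; apply: measurable_funX.
Qed.

Lemma axis_frame_trK (w0 P : 'M[R]_3) : axis_frame w0 P -> P *m P^T = 1%:M.
Proof. by case=> /mulmx1C. Qed.

(** Read in the frame [P], the matrix of [w] is skew with zero last row and column, so it has a
    single free entry [a]; both sides are then [a ^+ 2] times the squared length of the first two
    coordinates. *)
Lemma enorm_so3 (w0 P : 'M[R]_3) (t : R) (q : V) : so3 w0 -> axis_frame w0 P ->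
  enorm ((t *: w0) *m q) ^+ 2 = so3_inner (t *: w0) (t *: w0) * rho2 P q.
Proof.
move=> sw fP; have PP := axis_frame_trK fP; case: fP => P1 ker.
set w := t *: w0; pose W := P^T *m w *m P; pose u := P^T *m q.
have Wskew i j : W i j = - W j i.
  suff /matrixP/(_ i j) : W = - W^T by rewrite !mxE.
  rewrite /W /w !trmx_mul trmxK [(_ *: _)^T]linearZ/= sw scalerN mulNmx mulmxN.
  by rewrite opprK mulmxA.
have W2 i : W i ord_max = 0.
  have /matrixP/(_ i 0) : col ord_max W = 0.
    rewrite /W !colE -mulmxA -colE -mulmxA /w -scalemxAl.
    suff -> : w0 *m col ord_max P = 0 by rewrite scaler0 mulmx0.
    by apply/ker; exists 1; rewrite scale1r.
  by rewrite !mxE.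
have W2' i : W ord_max i = 0 by rewrite Wskew W2 oppr0.
have W0 i : W i i = 0 by have := Wskew i i; lra.
have -> : enorm (w *m q) = enorm (W *m u).
  rewrite -(enorm_orthogonal (Q := P^T)); last by rewrite trmxK.
  by congr enorm; rewrite /W /u -!mulmxA (mulmxA P) PP mul1mx.
have -> : so3_inner w w = so3_inner W W.
  rewrite /so3_inner; congr (- (_ * _)).
  by rewrite /W -!mulmxA (mulmxA P) PP mul1mx [in RHS]mxtrace_mulC -!mulmxA PP mulmx1.
rewrite enorm_sqr /so3_inner /mxtrace !sum3 !mxE !sum3 /rho2 -/u.
by rewrite !W2 !W2' !W0 (Wskew 1 0); field.
Qed.

(** An orthogonal [Q] preserves Lebesgue measure and the ball, and the second hypothesis makes it
    preserve the density. *)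
Lemma nu_preserves (m r beta : R) (w Q : 'M[R]_3) : Q^T *m Q = 1%:M ->
  (forall q : V, enorm (w *m (Q *m q)) = enorm (w *m q)) ->
  preserves (nu m r beta w) (mulmx Q).
Proof.
move=> QQ wQ; split; first exact: measurable_mulmx.
move=> A mA; rewrite /nu.
have pQ : preserves (@lebesgue3 R) (mulmx Q).
  by split; [exact: measurable_mulmx|move=> B mB; exact: lebesgue3_orthogonal].
have mAr : measurable (A `&` eball r).
  by apply: measurableI => //; exact: measurable_eball.
pose h q : \bar R := (boltzmann m beta w q / Zrot m r beta w)%:E.
rewrite -[RHS](@ge0_integral_preserves _ _ _ _ _ _ h pQ mAr).
- rewrite -[LHS]/(\int[lebesgue3]_(q in mulmx Q @^-1` A `&` eball r) h q)%E.
  have -> : mulmx Q @^-1` A `&` eball r = mulmx Q @^-1` (A `&` eball r).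
    by apply/seteqP; split => q /=; rewrite /eball/= enorm_orthogonal.
  by apply: eq_integral => q _; rewrite /h /boltzmann wQ.
- apply/measurable_EFinP; apply: measurable_funTS; apply: measurable_funM => //.
  exact: measurable_boltzmann.
- by move=> q _; rewrite lee_fin divr_ge0 ?expR_ge0 ?Zrot_ge0.
Qed.

Lemma eball_translate (c : V) (e : R) :
  lebesgue3 [set q | enorm (q - c) < e] = lebesgue3 (eball e).
Proof.
rewrite -(lebesgue3_translate (- c) (measurable_eball e)).
by congr (lebesgue3 _); apply/seteqP; split => q; rewrite /eball/= addrC.
Qed.

(** Bounding [Zrot] below by the contribution of a small ball far from the axis leaves a ratio of
    volumes, which is [C], times a quotient of exponentials. It matters that [C] and [kappa] are
    chosen before [beta] and [t]. *)
Lemma nu_inner_cylinder_le (m r : R) (w0 P : 'M[R]_3) (eta : R) : 0 < m -> 0 < r ->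
    so3 w0 -> axis_frame w0 P -> 0 < eta < r ->
  exists C kappa : R, [/\ 0 < C, 0 < kappa & forall beta t, 
    let L := beta * so3_inner (t *: w0) (t *: w0) in 0 <= L ->
    (nu m r beta (t *: w0) [set q | (rho2 P q <= (r - eta) ^+ 2)%R]
      <= (C * expR (- (kappa * L)))%:E)%E].
Proof.
move=> m0 r0 sw fP /andP[e0 er].
(* A ball of radius [e] centred at distance [r - e] from the origin touches the sphere from inside.
   If its centre lies in the rotation plane, its points are at distance more than
   [r - 2 * e = r - eta / 2] from the axis. *)
pose e := eta / 4; pose s := r - e.
have eb0 : 0 < e by rewrite divr_gt0.
pose vol x := fine (lebesgue3 (eball x : set V)).
have volE x : lebesgue3 (eball x : set V) = (vol x)%:E.
  by rewrite fineK// ge0_fin_numE ?eball_finite.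
have vol0 x : 0 < x -> 0 < vol x.
  by move=> x0; rewrite -lte_fin -volE eball_gt0.
(* The density on the bad set is at most that of [rho^2 = a], and the ball of
   radius [e] centred at distance [s] from the axis lies in [rho^2 >= b], [b > a]. *)
pose a := (r - eta) ^+ 2; pose b := (r - eta / 2) ^+ 2.
exists (vol r / vol e), (2^-1 * m * (b - a)); split.
- by rewrite divr_gt0 ?vol0.
- by rewrite mulr_gt0 ?mulr_gt0 ?invr_gt0// /a /b; nra.
move=> beta t L L0; set w := t *: w0.
have mL0 : 0 <= 2^-1 * m * L by apply: mulr_ge0 => //; rewrite mulr_ge0 ?invr_ge0// ltW.
have [Z0 ZE] := integral_boltzmannE m beta w r0.
have bE q : boltzmann m beta w q = expR (2^-1 * m * L * rho2 P q).
  rewrite /boltzmann (enorm_so3 t q sw fP) /L -/w; congr expR; ring.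
pose c : V := P *m cart (s, 0, 0).
pose B : set V := [set q | enorm (q - c) < e].
have mB : measurable B.
  have -> : B = (fun q => - c + q) @^-1` (eball e).
    by apply/seteqP; split => q; rewrite /B /eball/= addrC.
  apply: measurable_preimage (measurable_eball e).
  apply/measurable_fun_colP => i; under eq_fun do rewrite mxE.
  by apply: measurable_funD => //; exact: measurable_coor.
have Bsub q : B q -> eball r q /\ b <= rho2 P q.
  rewrite /B /eball/= => qc.
  have PP := axis_frame_trK fP.
  have n1 : enorm (q - c) ^+ 2 < e ^+ 2.
    by rewrite ltr_pXn2r// ?nnegrE ?enorm_ge0 ?(ltW eb0).
  have t1 : P^T^T *m P^T = 1%:M by rewrite trmxK.
  have cE : P^T *m c = cart (s, 0, 0) by rewrite /c mulmxA fP.1 mul1mx.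
  move: n1; rewrite -(enorm_orthogonal _ t1) mulmxBr cE enorm_sqr.
  have uE i : (P^T *m q - cart (s, 0, 0)) i 0 = (P^T *m q) i 0 - [:: s; 0; 0]`_i.
    by rewrite mxE; congr (_ + _); rewrite !mxE.
  rewrite sum3 !uE /= !subr0 => n1.
  have h : `|(P^T *m q) 0 0 - s| < e.
    rewrite -(@ltr_pXn2r _ 2)// ?nnegrE ?(ltW eb0)// real_normK ?num_real//.
    by apply: le_lt_trans n1; rewrite -addrA lerDl addr_ge0// sqr_ge0.
  move: h; rewrite ltr_norml => /andP[h1 h2].
  split.
    rewrite -(@ltr_pXn2r _ 2)// ?nnegrE ?enorm_ge0 ?(ltW r0)//.
    rewrite -(enorm_orthogonal _ t1) enorm_sqr sum3.
    move: n1 h1 h2; set x := (P^T *m q) 0 0; set y := _ 1 0; set z := _ ord_max 0.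
    rewrite /s => n1 h1 h2.
    (* As [x < s + e = r], the right-hand side is at most [e ^+ 2 + 2 * (r - e) * r - (r - e) ^+ 2],
       which equals [r ^+ 2]. *)
    have : x ^+ 2 + y ^+ 2 + z ^+ 2 < e ^+ 2 + 2 * (r - e) * x - (r - e) ^+ 2 by lra.
    have : (r - e) * x <= (r - e) * r by rewrite ler_wpM2l//; rewrite /e in h2 *; lra.
    by rewrite /e; lra.
  rewrite /rho2 /b; apply: (@le_trans _ _ ((P^T *m q) 0 0 ^+ 2)).
    by rewrite ler_pXn2r// ?nnegrE; rewrite /s /e in h1; lra.
  by rewrite lerDl sqr_ge0.
have mb : measurable_fun setT (EFin \o boltzmann m beta w).
  by apply/measurable_EFinP; exact: measurable_boltzmann.
have Zge : vol e * expR (2^-1 * m * L * b) <= Zrot m r beta w.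
  rewrite -lee_fin -ZE.
  apply: (@le_trans _ _ (\int[lebesgue3]_(q in B) (boltzmann m beta w q)%:E)%E).
    rewrite mulrC EFinM -volE -(eball_translate c e) -integral_cst//.
    apply: ge0_le_integral => //.
    - by move=> q _; rewrite lee_fin expR_ge0.
    - exact: measurable_funTS.
    by move=> q Bq; rewrite lee_fin bE ler_expR ler_wpM2l ?(Bsub _ Bq).2.
  apply: ge0_subset_integral => //.
  - exact: measurable_eball.
  - exact: measurable_funTS.
  - by move=> q _; rewrite lee_fin expR_ge0.
  - by move=> q /Bsub[].
pose bad := [set q : V | rho2 P q <= (r - eta) ^+ 2].
have mbad : measurable (bad `&` eball r).
  apply: measurableI; last exact: measurable_eball.
  have -> : bad = rho2 P @^-1` `]-oo, (r - eta) ^+ 2].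
    by apply/seteqP; split => q; rewrite /= in_itv.
  by apply: measurable_preimage => //; exact: measurable_rho2.
rewrite /nu; set K := expR (2^-1 * m * L * a) / Zrot m r beta w.
have K0 : 0 <= K by rewrite divr_ge0 ?expR_ge0// ltW.
apply: (@le_trans _ _ (\int[lebesgue3]_(q in bad `&` eball r) (cst K%:E) q)%E).
  apply: ge0_le_integral => //.
  - by move=> q _; rewrite lee_fin divr_ge0 ?expR_ge0// ltW.
  - apply/measurable_EFinP; apply: measurable_funTS; apply: measurable_funM => //.
    exact: measurable_boltzmann.
  move=> q [bq _]; rewrite lee_fin /K ler_wpM2r ?invr_ge0 ?(ltW Z0)//.
  by rewrite bE ler_expR ler_wpM2l.
rewrite integral_cst//.
apply: (@le_trans _ _ (K%:E * (vol r)%:E)%E).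
  rewrite lee_pmul2l ?lte_fin ?divr_gt0 ?expR_gt0// -volE.
  by apply: le_measure; rewrite ?inE//; exact: measurable_eball.
rewrite -EFinM lee_fin /K.
rewrite mulrC mulrA ler_pdivrMr//.
apply: (@le_trans _ _ (vol r / vol e * expR (- (2^-1 * m * (b - a) * L)) *
   (vol e * expR (2^-1 * m * L * b)))); last first.
  by rewrite ler_wpM2l// mulr_ge0 ?expR_ge0// divr_ge0// ltW// vol0.
have -> : expR (2^-1 * m * L * a) =
   expR (- (2^-1 * m * (b - a) * L)) * expR (2^-1 * m * L * b).
  by rewrite -expRD; congr expR; ring.
rewrite le_eqVlt; apply/orP; left; apply/eqP; field.
by rewrite gt_eqF// vol0.
Qed.

End rotating_gas_estimates.

(** * Continuous functions of a column vector *)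

Section col_topology.
Context {R : realType}.

Lemma nbhs_colP n (x : 'cV[R]_n) (A : set 'cV[R]_n) : nbhs x A <->
  exists2 e : R, 0 < e & forall y : 'cV[R]_n, (forall i, `|x i 0 - y i 0| < e) -> A y.
Proof.
split.
  move=> /nbhs_ballP[e /= e0 xeA]; exists e => // y xy; apply: xeA.
  by split => // i j; rewrite (ord1 j); exact: xy.
move=> [e e0 xeA]; apply/nbhs_ballP; exists e => //= y [_ xy]; apply: xeA => i.
exact: xy.
Qed.

(** This links the topology with the sigma-algebra generated by the coordinates: an open set is the
    union of the countably many boxes with rational centre and radius that it contains. *)
Lemma open_measurable_col n (U : set 'cV[R]_n) : open U -> measurable U.
Proof.
move=> oU.
pose box (c : 'cV[rat]_n * rat) : set 'cV[R]_n :=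
  \bigcap_(i in [set: 'I_n])
    ((fun q : 'cV[R]_n => q i 0) @^-1` ball (ratr (c.1 i 0) : R) (ratr c.2)).
have -> : U = \bigcup_c (if `[< box c `<=` U >] then box c else set0).
  apply/seteqP; split => [q Uq|q [c _]]; last by case: ifPn => // /asboolP; apply.
  have /nbhs_colP[e e0 qeU] : nbhs q U by exact: open_nbhs_nbhs.
  (* With a rational centre within [e / 4] of [q] and a radius [k] between [e / 4] and [e / 2], the
     box contains [q] and stays within [3 * e / 4] of it. *)
  have [k] : exists k : rat, (ratr k : R) \in `]e / 4, e / 2[.
    by apply: rat_in_itvoo; lra.
  rewrite in_itv/= => /andP[ke1 ke2].
  have cP i : exists c : rat, (ratr c : R) \in `]q i 0 - e / 4, q i 0 + e / 4[.
    by apply: rat_in_itvoo; lra.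
  pose c : 'cV[rat]_n := \col_i (sval (cid (cP i))).
  have cq i : `|ratr (c i 0) - q i 0| < e / 4.
    rewrite mxE; case: cid => d /=; rewrite in_itv/= ltr_norml => /andP[? ?].
    by apply/andP; split; lra.
  have boxU : box (c, k) `<=` U.
    move=> y ybox; apply: qeU => i; have /= := ybox i Logic.I; rewrite /ball/= => h.
    move: h (cq i); rewrite !ltr_norml => /andP[? ?] /andP[? ?].
    by apply/andP; split; lra.
  exists (c, k) => //; case: ifPn => [_|/asboolP//] i _ /=.
  by rewrite /ball/= (lt_trans (cq i)).
apply: countable_bigcupT_measurable => [|c].
  exact: countableP.
case: ifPn => // _; apply: fin_bigcap_measurable => // i _.
apply: measurable_preimage; first exact: measurable_coor.
exact: open_measurable (ball_open _ _).
Qed.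

Lemma within_continuous_measurable_col n (D : set 'cV[R]_n) (f : 'cV[R]_n -> R) :
  measurable D -> {within D, continuous f} -> measurable_fun D f.
Proof.
move=> mD /continuousP cf; apply: (measurability _ (RGenOpens.measurableE R)).
move=> _ [_ [a [b ->] <-]].
have : open (f @^-1` `]a, b[ : set (subspace D)) by exact/cf/interval_open.
move=> /open_subspaceP[V oV VD].
by rewrite setIC -VD; apply: measurableI => //; exact: open_measurable_col.
Qed.

Lemma within_continuous_colP n (D : set 'cV[R]_n) (f : 'cV[R]_n -> R) x e :
    {within D, continuous f} -> D x -> 0 < e ->
  exists2 d : R, 0 < d & forall y : 'cV[R]_n, D y ->
    (forall i, `|x i 0 - y i 0| < d) -> `|f x - f y| < e.
Proof.
move=> /subspace_continuousP cf Dx e0.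
have /cf/cvgrPdist_lt/(_ _ e0)/nbhs_colP[d d0 H] := Dx.
by exists d => // y Dy xy; exact: H.
Qed.

(** Serves to carry compactness of a cube from row vectors to columns. *)
Lemma trmx_continuous : continuous (@trmx R 1 3).
Proof.
move=> q A /nbhs_colP[e e0 H]; apply/nbhs_ballP; exists e => //= y [_ qy].
by apply: H => i; rewrite !mxE; exact: qy.
Qed.

(** The ball lies in a cube, compact as a product of segments, and is closed as the preimage of a
    half-line under the polynomial [s]. *)
Lemma closed_eball_compact (r : R) : compact (closed_eball r).
Proof.
pose cube : set 'rV[R]_3 := [set v | forall i, `[- r, r]%classic (v ord0 i)].
have ccube : compact (@trmx R 1 3 @` cube).
  apply: continuous_compact.
    by apply: continuous_subspaceT; exact: trmx_continuous.
  by apply: (@rV_compact R 3 (fun=> `[- r, r]%classic)) => _; exact: segment_compact.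
apply: subclosed_compact ccube _.
  pose s := fun q : 'cV[R]_3 => q 0 0 * q 0 0 + q 1 0 * q 1 0 + q ord_max 0 * q ord_max 0.
  have cs : continuous s.
    have cc i : continuous (fun q : 'cV[R]_3 => q i 0 * q i 0).
      have c1 : continuous (fun q : 'cV[R]_3 => q i 0) by exact: coord_continuous.
      by move=> q; exact: (cvgM (c1 q) (c1 q)).
    by move=> q; exact: (cvgD (cvgD (cc 0 q) (cc 1 q)) (cc ord_max q)).
  have [r0|r0] := leP 0 r; last first.
    have -> : closed_eball r = set0; last exact: closed0.
    apply/seteqP; split => // q; rewrite /closed_eball/= => /le_lt_trans /(_ r0).
    by rewrite ltNge enorm_ge0.
  have -> : closed_eball r = s @^-1` [set x | x <= r ^+ 2].
    have sE q : s q = enorm q ^+ 2 by rewrite enorm_sqr sum3 !expr2.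
    apply/seteqP; split => q; rewrite /closed_eball/= sE;
      by rewrite ler_pXn2r// ?nnegrE ?enorm_ge0.
  by apply: closed_comp => [q _|]; [exact: cs|exact: closed_le].
move=> q qr; exists q^T; last by rewrite trmxK.
move=> i; rewrite /= mxE in_itv/= -ler_norml.
exact: le_trans (coor_le_enorm q i) qr.
Qed.

(** Heine-Cantor through the near-covering form of compactness: the modulus runs along the filter
    [0^'+], so it is enough to find, around each point, a neighbourhood on which all small moduli
    work. *)
Lemma uniform_continuity_eball (r : R) (f : 'cV[R]_3 -> R) (e : R) :
    {within closed_eball r, continuous f} -> 0 < e ->
  exists2 d : R, 0 < d & forall x y, closed_eball r x -> closed_eball r y ->
    (forall i, `|x i 0 - y i 0| < d) -> `|f x - f y| < e.
Proof.
move=> cf e0.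
have /compact_near_coveringP/near_covering_withinP cov := @closed_eball_compact r.
have [|d /= d0 H] := cov R 0^'+ (fun d x => forall y, closed_eball r y ->
    (forall i, `|x i 0 - y i 0| < d) -> `|f x - f y| < e) _ _.
  move=> x Kx; have e20 : 0 < e / 2 by rewrite divr_gt0.
  have [d d0 H] := within_continuous_colP cf Kx e20.
  exists ([set y : 'cV[R]_3 | forall i, `|x i 0 - y i 0| < d / 2],
          [set t | t < d / 2]).
    split; first by apply/nbhs_colP; exists (d / 2) => //; rewrite divr_gt0.
    by apply: nbhs_right_lt; rewrite divr_gt0.
  move=> [x' t] /= [xx' td] Kx' y Ky x'y.
  have h1 : `|f x - f x'| < e / 2.
    by apply: H => // i; rewrite (lt_trans (xx' i))// gtr_pMr// invf_lt1// ltr1n.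
  have h2 : `|f x - f y| < e / 2.
    apply: H => // i; rewrite (splitr d).
    rewrite (le_lt_trans (ler_distD (x' i 0) _ _))// ltrD// (lt_trans (x'y i))//.
  rewrite (splitr e) (le_lt_trans (ler_distD (f x) _ _))// ltrD// distrC//.
(* The filter provides every modulus strictly between [0] and [d], hence not [d] itself. *)
exists (d / 2); first by rewrite divr_gt0.
move=> x y Kx Ky; apply: (H (d / 2)) => //=.
- by rewrite sub0r normrN gtr0_norm ?divr_gt0// gtr_pMr// invf_lt1// ltr1n.
- by rewrite divr_gt0.
Qed.

Lemma bounded_closed_eball (r : R) (f : 'cV[R]_3 -> R) :
    {within closed_eball r, continuous f} ->
  exists2 M : R, 0 < M & forall q, closed_eball r q -> `|f q| <= M.
Proof.
move=> cf.
have /compact_bounded[M [_ H]] := continuous_compact cf (@closed_eball_compact r).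
(* Every real above [M] is a bound; this one is moreover positive. *)
exists (`|M| + 1); first by rewrite ltr_wpDl.
move=> q qr; apply: (H (`|M| + 1)); last by exists q.
by rewrite (le_lt_trans (ler_norm M))// ltrDl.
Qed.

End col_topology.

(** * Averages of bounded functions *)

Section averages.
Context {R : realType}.
Local Notation RR := (measurableTypeR R).
Local Notation leb := (@lebesgue_measure R).

Lemma bounded_integrable d (T : measurableType d) (mu : {measure set T -> \bar R})
    (D : set T) (f : T -> R) (M : R) : measurable D -> (mu D < +oo)%E ->
    measurable_fun D f -> (forall x, D x -> `|f x| <= M) ->
  mu.-integrable D (EFin \o f).
Proof.
move=> mD Dfin mf fM; apply: measurable_bounded_integrable => //.
exists M; split; first exact: num_real.
by move=> x Mx y Dy; exact: le_trans (fM y Dy) (ltW Mx).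
Qed.

Lemma probability_integrable d (T : measurableType d) (mu : probability T R)
    (f : T -> R) (M : R) :
    measurable_fun setT f -> (forall x, `|f x| <= M) ->
  mu.-integrable setT (EFin \o f).
Proof.
move=> mf fM; apply: (@bounded_integrable _ _ _ _ _ M) => //.
by apply: (le_lt_trans (probability_le1 _ _)) => //; rewrite ltry.
Qed.

Lemma Rintegral_preserves d (T : measurableType d) (mu : {measure set T -> \bar R})
    (f : T -> T) (D : set T) (g : T -> R) :
    preserves mu f -> measurable D -> measurable_fun setT g ->
    mu.-integrable (f @^-1` D) (EFin \o (g \o f)) ->
  \int[mu]_(x in f @^-1` D) g (f x) = \int[mu]_(x in D) g x.
Proof.
move=> [mf fE] mD mg ig; rewrite /Rintegral; congr fine.
have meg : measurable_fun setT (EFin \o g) by exact/measurable_EFinP.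
rewrite -[LHS](integral_pushforward mf meg ig mD).
by apply: eq_measure_integral => //= A mA _; exact: fE.
Qed.

(** [integral_uniform] is applied to the positive and negative parts separately; integrability makes
    their difference meaningful. *)
Lemma Rintegral_uniform (a b : R) (ab : a < b) (f : R -> R) :
    measurable_fun setT (f : RR -> R) ->
    (uniform_prob ab).-integrable setT (EFin \o f) ->
    leb.-integrable `[a, b] (EFin \o f) ->
  (((b - a)^-1%:E * \int[leb]_(x in `[a, b]) (f x)%:E)
     = (\int[uniform_prob ab]_x f x)%:E)%E.
Proof.
move=> mf iU iL; rewrite /Rintegral fineK; last exact: integrable_fin_num.
have mEf : measurable_fun setT (EFin \o f) by exact/measurable_EFinP.
rewrite [RHS]integralE [X in (_ * X)%E]integralE.
rewrite muleBr//; last exact: integrable_add_def.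
by rewrite !integral_uniform//; [exact: measurable_funeneg|exact: measurable_funepos].
Qed.

(** After translation the domain is []phi, phi + T]], cut at [T]; the piece beyond [T] is moved back
    by one period onto []0, phi]]. Half-open intervals, which differ from the closed ones by a null
    set, make the pieces disjoint. *)
Lemma Rintegral_periodic_shift (h : R -> R) (T phi M : R) :
    measurable_fun setT (h : RR -> R) -> (forall x, `|h x| <= M) ->
    periodic h T -> 0 <= phi <= T ->
  \int[leb]_(x in `[0, T]) h (phi + x) = \int[leb]_(x in `[0, T]) h x.
Proof.
move=> mh hM hT /andP[phi0 phiT].
have fin (i : interval R) a b : [set` i] `<=` `[a, b]%classic ->
    (leb ([set` i] : set RR) < +oo)%E.
  move=> iab; apply: (@le_lt_trans _ _ (leb (`[a, b]%classic : set RR))).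
    by apply: le_measure; rewrite ?inE.
  by rewrite lebesgue_measure_itv/=; case: ifPn => // _; rewrite ltry.
have itg a c d (b1 b2 : bool) :
    leb.-integrable [set` Interval (BSide b1 c) (BSide b2 d)]
      (EFin \o (fun x => h (a + x))).
  apply: (@bounded_integrable _ RR leb _ _ M) => //; last first.
    by apply: measurable_funTS; apply: measurableT_comp => //; exact: measurable_funD.
  apply: (fin _ c d) => x /=; rewrite !in_itv/=; clear.
  by case: b1; case: b2 => /andP[? ?]; apply/andP; split => //; exact: ltW.
have itg0 c d (b1 b2 : bool) :
    leb.-integrable [set` Interval (BSide b1 c) (BSide b2 d)] (EFin \o h).
  have -> : h = (fun x => h (0 + x)) by apply/funext => x; rewrite add0r.
  exact: itg.
have shift a c d : \int[leb]_(x in `]c, d]) h (a + x) =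
    \int[leb]_(x in `]a + c, a + d]) h x.
  have pre : (fun x : RR => a + x : RR) @^-1` `]a + c, a + d] = `]c, d]%classic.
    by apply/seteqP; split => x /=; rewrite !in_itv/= ltrD2l lerD2l.
  rewrite -pre; apply: (Rintegral_preserves (lebesgue_measure_translate a)) => //.
  by rewrite pre; exact: itg.
have split_itv (c e d : R) : c <= e -> e <= d ->
    \int[leb]_(x in `]c, d]) h x =
    \int[leb]_(x in `]c, e]) h x + \int[leb]_(x in `]e, d]) h x.
  move=> ce ed; have -> : `]c, d]%classic = `]c, e] `|` `]e, d].
    by rewrite -itv_bndbnd_setU// bnd_simp.
  rewrite Rintegral_setU//.
  - by rewrite -itv_bndbnd_setU ?bnd_simp//; exact: itg0.
  - apply/disj_setPS => x /= [] /=; rewrite !in_itv/= => /andP[_ xe] /andP[ex _].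
    by move: (lt_le_trans ex xe); rewrite ltxx.
rewrite -!Rintegral_itv_obnd_cbnd; last 2 first.
- exact: itg0.
- exact: itg.
rewrite shift addr0 (split_itv phi T)//; last by rewrite lerDr.
rewrite (split_itv 0 phi T)// addrC; congr (_ + _).
rewrite [phi + T]addrC -{1}[T]addr0 -shift.
by apply: eq_Rintegral => x _; rewrite addrC hT.
Qed.

(** By Fubini the integration over [N] can be done first; invariance makes its value independent of
    [i], and [U] has mass one. Measurability of the mean is also part of Fubini. *)
Lemma Rintegral_average d (T : measurableType d) d' (I : measurableType d')
    (N : probability T R) (U : probability I R) (act : I -> T -> T)
    (g : T -> R) (M : R) :
    measurable_fun setT (fun z : T * I => act z.2 z.1) ->
    (forall i, preserves N (act i)) ->
    measurable_fun setT g -> (forall x, `|g x| <= M) ->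
  measurable_fun setT (fun q => \int[U]_i g (act i q)) /\
  \int[N]_q g q = \int[N]_q \int[U]_i g (act i q).
Proof.
move=> mact Nact mg gM.
have ig : (N \x U)%E.-integrable setT (EFin \o (fun z : T * I => g (act z.2 z.1))).
  apply: (@probability_integrable _ _ (N \x U)%E _ M) => //.
  exact: measurableT_comp mg mact.
have fE q : (\int[U]_i (g (act i q))%:E = (\int[U]_i g (act i q))%:E)%E.
  rewrite fineK//; apply: integrable_fin_num => //.
  apply: (@probability_integrable _ _ U _ M) => //.
  apply: measurableT_comp mg _.
  apply: (@measurableT_comp _ _ _ _ _ _ (fun z : T * I => act z.2 z.1) _ (pair q)) => //.
split.
  apply/measurable_EFinP.
  have := measurable_fubini_F ig; rewrite /fubini_F/=.
  by under eq_fun do rewrite fE.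
rewrite /Rintegral; congr fine.
under [RHS]eq_integral do rewrite -fE.
have := Fubini ig => /= ->.
transitivity (\int[U]_i (\int[N]_q g q)%:E)%E.
  by rewrite integral_cst//= probability_setT mule1 fineK//;
     apply: integrable_fin_num => //; exact: probability_integrable gM.
apply: eq_integral => i _.
have igi : N.-integrable setT (EFin \o (g \o act i)).
  apply: (@probability_integrable _ _ N _ M) => [|x]; last exact: gM.
  by apply: measurableT_comp mg _; case: (Nact i).
have H := @Rintegral_preserves _ _ N (act i) setT g (Nact i) measurableT mg igi.
transitivity ((\int[N]_q g (act i q))%:E); first by congr EFin; exact/esym/H.
by rewrite /Rintegral fineK//; exact: integrable_fin_num igi.
Qed.

(** The function [e + 2 * M * \1_bad] dominates the distance from [F] to [a]. With [bad] empty and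
    [a = 0], this is the usual bound on an integral by a bound on its integrand. *)
Lemma probability_Rintegral_dist d (T : measurableType d) (N : probability T R)
    (F : T -> R) (M a e : R) (bad : set T) :
    measurable_fun setT F -> (forall x, `|F x| <= M) -> `|a| <= M -> 0 <= e ->
    measurable bad -> (forall x, ~ bad x -> `|F x - a| <= e) ->
  `|\int[N]_x F x - a| <= e + 2 * M * fine (N bad).
Proof.
move=> mF FM aM e0 mbad Fa.
have M0 : 0 <= M by exact: le_trans aM.
have iF : N.-integrable setT (EFin \o F) by exact: probability_integrable FM.
have icst c : N.-integrable setT (EFin \o (cst c : T -> R)).
  by apply: (@probability_integrable _ _ N _ `|c|).
have cE c : \int[N]_x c = c by rewrite Rintegral_cst//= probability_setT mulr1.
rewrite -[X in _ - X]cE -RintegralB//; last exact: icst.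
have mFa : measurable_fun setT (fun x => F x - a) by exact: measurable_funB.
apply: le_trans (le_normr_Rintegral _ _) _ => //.
  by apply: (@probability_integrable _ _ N _ (M + M)) => // x;
     rewrite (le_trans (ler_normB _ _))// lerD.
have ind : \int[N]_x (2 * M * \1_bad x) = 2 * M * fine (N bad).
  rewrite RintegralZl//; first by rewrite /Rintegral integral_indic// setIT.
  apply: (@probability_integrable _ _ N _ 1) => // x.
  by rewrite indicE; case: (_ \in _); rewrite ?normr1 ?normr0.
rewrite -ind -[X in _ <= X + _]cE -RintegralD//; [|exact: icst|]; last first.
  apply: (@probability_integrable _ _ N _ (2 * M)) => [|x].
    by apply: measurable_funM => //; exact: measurable_indic.
  rewrite indicE; case: (_ \in _); rewrite ?mulr1 ?mulr0 ?normr0 ?mulr_ge0//.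
  by rewrite ger0_norm// mulr_ge0.
apply: (le_Rintegral (mu := N)) => //.
- apply: (@probability_integrable _ _ N _ (M + M)) => [|x].
    exact: measurableT_comp.
  by rewrite normr_id (le_trans (ler_normB _ _))// lerD.
- apply: (@probability_integrable _ _ N _ (e + 2 * M)) => [|x].
    by apply: measurable_funD => //; apply: measurable_funM => //; exact: measurable_indic.
  rewrite indicE; case: (_ \in _); rewrite ?mulr1 ?mulr0 ?addr0.
    by rewrite ger0_norm// addr_ge0// mulr_ge0.
  by rewrite ger0_norm// lerDl mulr_ge0.
move=> x _; rewrite indicE; case: (boolP (x \in bad)) => [_|].
  rewrite mulr1 (le_trans (ler_normB _ _))// (le_trans (lerD (FM x) aM))//.
  by lra.
by rewrite notin_setE mulr0 addr0 => /Fa.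
Qed.

End averages.

(** * Rotations about an axis and cylindrical coordinates *)

Section axis_rotation.
Context {R : realType}.
Local Notation RR := (measurableTypeR R).
Local Notation V := 'cV[R]_3.
Implicit Types (P : 'M[R]_3) (q : V) (theta phi rho x y z : R).

Lemma cart_eta q : q = cart (q 0 0, q 1 0, q ord_max 0).
Proof.
apply/matrixP => i j; rewrite mxE (ord1 j).
by case: i => [[|[|[|//]]] /= ?]; congr (q _ _); apply/val_inj.
Qed.

Definition rotz theta : 'M[R]_3 := \matrix_(i, j)
  nth 0 (nth [::] [:: [:: cos theta; - sin theta; 0];
                       [:: sin theta; cos theta; 0];
                       [:: 0; 0; 1]] i) j.

Lemma rotz_cart theta x y z : rotz theta *m cart (x, y, z) =
  cart (cos theta * x - sin theta * y, sin theta * x + cos theta * y, z).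
Proof.
apply/matrixP => i j; rewrite mxE sum3 !mxE/=.
by case: i => [[|[|[|//]]] /= ?]; ring.
Qed.

Lemma rotz_orthogonal theta : (rotz theta)^T *m rotz theta = 1%:M.
Proof.
have cs := cos2Dsin2 theta.
apply/matrixP => i j; rewrite mxE sum3 !mxE/=.
by case: i => [[|[|[|//]]] /= ?]; case: j => [[|[|[|//]]] /= ?];
  rewrite /eq_op/=; lra.
Qed.

Definition axis_rot P theta : 'M[R]_3 := P *m rotz theta *m P^T.

Lemma axis_rot_orthogonal P theta : P^T *m P = 1%:M ->
  (axis_rot P theta)^T *m axis_rot P theta = 1%:M.
Proof.
move=> PP; rewrite /axis_rot !trmx_mul trmxK -!mulmxA (mulmxA P^T) PP mul1mx.
by rewrite (mulmxA (rotz theta)^T) rotz_orthogonal mul1mx; exact: mulmx1C.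
Qed.

Lemma rho2_axis_rot P theta q : P^T *m P = 1%:M ->
  rho2 P (axis_rot P theta *m q) = rho2 P q.
Proof.
move=> PP; rewrite /rho2 /axis_rot -!mulmxA (mulmxA P^T) PP mul1mx.
rewrite [P^T *m q]cart_eta rotz_cart !mxE/=.
have cs := cos2Dsin2 theta; set c := cos theta in cs *; set s := sin theta in cs *.
rewrite -[RHS]mul1r -cs; ring.
Qed.

Lemma axis_rot_cylindrical P theta phi rho z :
  P^T *m P = 1%:M ->
  axis_rot P theta *m cylindrical P rho phi z = cylindrical P rho (phi + theta) z.
Proof.
move=> PP; rewrite /axis_rot /cylindrical -!mulmxA (mulmxA P^T) PP mul1mx rotz_cart.
congr (_ *m cart (_, _, _)); first by rewrite cosD; ring.
by rewrite sinD; ring.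
Qed.

Lemma measurable_cart_coor d (T : measurableType d) (f g h : T -> R) :
  measurable_fun setT f -> measurable_fun setT g -> measurable_fun setT h ->
  measurable_fun setT (fun t => cart (f t, g t, h t)).
Proof.
move=> mf mg mh; apply/measurable_fun_colP => -[[|[|[|//]]] i3];
  by under eq_fun do rewrite mxE/=.
Qed.

Lemma measurable_cosT d (T : measurableType d) (f : T -> R) :
  measurable_fun setT f -> measurable_fun setT (fun t => cos (f t)).
Proof.
by apply: measurableT_comp; exact: continuous_measurable_fun (@continuous_cos R).
Qed.

Lemma measurable_sinT d (T : measurableType d) (f : T -> R) :
  measurable_fun setT f -> measurable_fun setT (fun t => sin (f t)).
Proof.
by apply: measurableT_comp; exact: continuous_measurable_fun (@continuous_sin R).
Qed.

(** Fubini needs measurability jointly in the point and the angle, which is read off the explicit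
    coordinates. *)
Lemma measurable_axis_rot P :
  measurable_fun setT (fun z : V * RR => axis_rot P z.2 *m z.1).
Proof.
have E (z : V * RR) : axis_rot P z.2 *m z.1 = P *m cart
   (cos z.2 * (P^T *m z.1) 0 0 - sin z.2 * (P^T *m z.1) 1 0,
    sin z.2 * (P^T *m z.1) 0 0 + cos z.2 * (P^T *m z.1) 1 0,
    (P^T *m z.1) ord_max 0).
  by rewrite -rotz_cart -cart_eta /axis_rot !mulmxA.
under eq_fun do rewrite E.
apply: measurableT_comp (measurable_mulmx P) _.
have mc i : measurable_fun setT (fun z : V * RR => (P^T *m z.1) i 0).
  move: i; apply/measurable_fun_colP.
  exact: measurableT_comp (measurable_mulmx _) measurable_fst.
have mcos := measurable_cosT (@measurable_snd _ _ V RR).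
have msin := measurable_sinT (@measurable_snd _ _ V RR).
by apply: measurable_cart_coor => //; [apply: measurable_funB|apply: measurable_funD];
  apply: measurable_funM.
Qed.

Lemma measurable_cylindrical P rho z :
  measurable_fun setT (fun theta : RR => cylindrical P rho theta z).
Proof.
apply: measurableT_comp (measurable_mulmx P) _.
apply: measurable_cart_coor => //; apply: measurable_funM => //.
  by apply: measurable_cosT; exact: measurable_id.
by apply: measurable_sinT; exact: measurable_id.
Qed.

Lemma cylindrical_periodic P rho z : periodic (fun t => cylindrical P rho t z) (2 * pi).
Proof.
by move=> t; rewrite /cylindrical mulr_natl cosD2pi sinD2pi.
Qed.

(** The angle is [acos (x / rho)] in the upper half-plane and its reflection
    [2 * pi - acos (x / rho)] in the lower one; at the origin the angle [0] is taken. The range of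
    [phi] is the one required by the periodic shift. *)
Lemma polar_coordinates x y : exists rho phi,
  [/\ 0 <= rho, 0 <= phi <= 2 * pi, x = rho * cos phi & y = rho * sin phi].
Proof.
pose rho := Num.sqrt (x ^+ 2 + y ^+ 2).
have xy0 : 0 <= x ^+ 2 + y ^+ 2 by rewrite addr_ge0// sqr_ge0.
have rho2E : rho ^+ 2 = x ^+ 2 + y ^+ 2 by rewrite sqr_sqrtr.
have [r0|r0] := eqVneq rho 0.
  exists 0, 0; rewrite !mul0r lexx mulr_ge0 ?pi_ge0//.
  have : x ^+ 2 + y ^+ 2 == 0 by rewrite -rho2E r0 expr0n.
  by rewrite paddr_eq0 ?sqr_ge0// !sqrf_eq0 => /andP[/eqP -> /eqP ->].
have rho0 : 0 < rho by rewrite lt0r r0 sqrtr_ge0.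
have x2 : `|x| <= rho.
  rewrite -(@ler_pXn2r _ 2)// ?nnegrE ?(ltW rho0)// rho2E real_normK ?num_real//.
  by rewrite lerDl sqr_ge0.
have u1 : -1 <= x / rho <= 1.
  by rewrite -ler_norml normrM normfV (gtr0_norm rho0) ler_pdivrMr// mul1r.
have cE : x = rho * cos (acos (x / rho)).
  by rewrite acosK ?in_itv//= mulrC divfK.
have sE : rho * sin (acos (x / rho)) = `|y|.
  rewrite sin_acos// -[in X in X * _](gtr0_norm rho0) -sqrtr_sqr -sqrtrM ?sqr_ge0//.
  rewrite -sqrtr_sqr; congr Num.sqrt.
  by rewrite mulrBr mulr1 expr_div_n mulrCA divff ?mulr1 ?expf_neq0// rho2E; ring.
have a0 := acos_ge0 u1; have a1 := acos_lepi u1; have pi0 := pi_ge0 R.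
have [y0|y0] := leP 0 y.
  exists rho, (acos (x / rho)); rewrite sE ger0_norm//; split => //; first exact: ltW.
  by rewrite a0/=; lra.
exists rho, (2 * pi - acos (x / rho)).
have cc : cos (2 * pi - acos (x / rho)) = cos (acos (x / rho)).
  by rewrite addrC mulr_natl cosD2pi cosN.
have ss : sin (2 * pi - acos (x / rho)) = - sin (acos (x / rho)).
  by rewrite addrC mulr_natl sinD2pi sinN.
rewrite cc ss mulrN sE ltr0_norm// opprK; split => //; first exact: ltW.
by apply/andP; split; lra.
Qed.

Lemma enorm_cylindrical P rho theta z : P^T *m P = 1%:M ->
  enorm (cylindrical P rho theta z) ^+ 2 = rho ^+ 2 + z ^+ 2.
Proof.
move=> PP; rewrite /cylindrical enorm_orthogonal// enorm_sqr sum3 !mxE/=.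
by rewrite !exprMn -mulrDr cos2Dsin2 mulr1.
Qed.

(** At a common angle the difference is itself of cylindrical form, with the possibly negative
    radius [rho - rho']. *)
Lemma enorm_cylindricalB P rho rho' theta z z' : P^T *m P = 1%:M ->
  enorm (cylindrical P rho theta z - cylindrical P rho' theta z') ^+ 2 =
    (rho - rho') ^+ 2 + (z - z') ^+ 2.
Proof.
move=> PP; rewrite -(enorm_cylindrical _ theta _ PP); congr (enorm _ ^+ 2).
rewrite /cylindrical -mulmxBr; congr (_ *m _); apply/matrixP => i j.
by rewrite !mxE; case: i => [[|[|[|//]]] /= ?]; rewrite ?mulrBl.
Qed.

Lemma two_pi_gt0 : 0 < 2 * pi :> R.
Proof. by rewrite mulr_gt0 ?pi_gt0. Qed.

Local Notation U := (uniform_prob two_pi_gt0).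

Lemma Rintegral_uniform_circle (h : R -> R) (M : R) :
    measurable_fun setT (h : RR -> R) -> (forall t, `|h t| <= M) ->
  (((2 * pi)^-1%:E * \int[lebesgue_measure]_(t in `[0%R, (2 * pi)%R]) (h t)%:E)
     = (\int[U]_t h t)%:E)%E.
Proof.
move=> mh hM; rewrite -{1}[2 * pi]subr0; apply: Rintegral_uniform => //.
  by apply: (@probability_integrable _ _ _ U _ M).
apply: (@bounded_integrable _ _ RR lebesgue_measure _ _ M) => //.
  by rewrite /= lebesgue_measure_itv/= lte_fin two_pi_gt0 ltry.
exact: measurable_funTS.
Qed.

Lemma Rintegral_uniform_shift (h : R -> R) (phi M : R) :
    measurable_fun setT (h : RR -> R) -> (forall t, `|h t| <= M) ->
    periodic h (2 * pi) -> 0 <= phi <= 2 * pi ->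
  \int[U]_t h (phi + t) = \int[U]_t h t.
Proof.
move=> mh hM hT phi2pi; apply: EFin_inj.
have mhp : measurable_fun setT (fun t : RR => h (phi + t)).
  by apply: measurableT_comp => //; exact: measurable_funD.
rewrite -(Rintegral_uniform_circle mhp (fun t => hM _)).
rewrite -(Rintegral_uniform_circle mh hM).
have fin (g : R -> R) : measurable_fun setT (g : RR -> R) -> (forall t, `|g t| <= M) ->
   (\int[@lebesgue_measure R]_(t in `[0%R, (2 * pi)%R]) (g t)%:E)%E \is a fin_num.
  move=> mg gM; apply: integrable_fin_num => //.
  apply: (@bounded_integrable _ _ RR lebesgue_measure _ _ M) => //.
    by rewrite /= lebesgue_measure_itv/= lte_fin two_pi_gt0 ltry.
  exact: measurable_funTS.
rewrite -(fineK (fin _ mhp (fun t => hM _))) -(fineK (fin _ mh hM)).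
congr (_ * _%:E)%E; exact: Rintegral_periodic_shift hM hT phi2pi.
Qed.

End axis_rotation.

(** * The limit of fast rotation *)

Section concentration_limit.
Context {R : realType}.
Local Notation RR := (measurableTypeR R).
Local Notation V := 'cV[R]_3.
Local Notation U := (uniform_prob (@two_pi_gt0 R)).

(** Bounds on [f] hold only on a ball, whereas the averaging lemmas want functions bounded
    everywhere; extension by zero reconciles the two. *)
Lemma patch_bounded (D : set V) (f : V -> R) (M : R) : 0 <= M ->
  (forall q, D q -> `|f q| <= M) -> forall q, `|(f \_ D) q| <= M.
Proof.
move=> M0 fM q; rewrite patchE; case: ifPn => [/[!inE]/fM//|_].
by rewrite normr0.
Qed.

Lemma cylindrical_closed_eball (P : 'M[R]_3) (r theta : R) : 0 <= r ->
  P^T *m P = 1%:M -> closed_eball r (cylindrical P r theta 0).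
Proof.
move=> r0 PP; rewrite /closed_eball/= -(@ler_pXn2r _ 2) ?nnegrE ?enorm_ge0//.
by rewrite enorm_cylindrical// expr0n addr0.
Qed.

(** The real-valued counterpart of [great_circle_average], as an expectation under the uniform law
    of the angle. The cut-off uses the closed ball, since the great circle lies on its boundary. *)
Definition circle_mean (P : 'M[R]_3) (r : R) (f : V -> R) : R :=
  \int[U]_theta (f \_ (closed_eball r)) (cylindrical P r theta 0).

Lemma measurable_closed_eball (r : R) : measurable (closed_eball r).
Proof.
have -> : closed_eball r = enorm @^-1` `]-oo, r] :> set V.
  by apply/seteqP; split => q; rewrite /closed_eball /= in_itv.
by apply: measurable_preimage => //; exact: measurable_enorm.
Qed.

Lemma great_circle_averageE (P : 'M[R]_3) (r : R) (f : V -> R) (M : R) :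
    0 < r -> P^T *m P = 1%:M -> 0 <= M -> measurable_fun (closed_eball r) f ->
    (forall q, closed_eball r q -> `|f q| <= M) ->
  great_circle_average P r f = (circle_mean P r f)%:E.
Proof.
move=> r0 PP M0 mf fM.
have mg : measurable_fun setT (f \_ (closed_eball r)).
  by apply/(measurable_restrictT _ (measurable_closed_eball r)).
rewrite /circle_mean -(@Rintegral_uniform_circle _ _ M).
- rewrite /great_circle_average; congr (_ * _)%E.
  apply: eq_integral => t _; rewrite patchE.
  by rewrite mem_set//; exact: cylindrical_closed_eball (ltW r0) PP.
- exact: measurableT_comp mg (measurable_cylindrical P r 0).
- by move=> t; exact: patch_bounded.
Qed.

(** Rotating [q] sweeps the horizontal circle through it, and the initial angle [phi] disappears by
    periodicity. The two circles are then compared point by point at equal angles. *)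
Lemma rotation_mean_near_circle (P : 'M[R]_3) (r eta d e M : R) (f : V -> R) (q : V) :
    P^T *m P = 1%:M -> 0 < eta < r -> 0 < d -> 2 * r * eta <= d ^+ 2 -> 0 <= e ->
    measurable_fun (closed_eball r) f ->
    (forall q, closed_eball r q -> `|f q| <= M) ->
    (forall x y, closed_eball r x -> closed_eball r y ->
      (forall i, `|x i 0 - y i 0| < d) -> `|f x - f y| <= e) ->
    eball r q -> (r - eta) ^+ 2 < rho2 P q ->
  `|\int[U]_theta (f \_ (eball r)) (axis_rot P theta *m q) - circle_mean P r f| <= e.
Proof.
move=> PP /andP[eta0 etar] d0 etad e0 mf fM fe qr qrho.
have r0 : 0 < r by exact: lt_trans etar.
have M0 : 0 <= M by exact: le_trans (fM q (ltW qr)).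
have PP' : P *m P^T = 1%:M by exact: mulmx1C.
have sub : eball r `<=` (closed_eball r : set V) by move=> x; exact: ltW.
have mg : measurable_fun setT (f \_ (eball r)).
  apply/(measurable_restrictT _ (measurable_eball r)).
  exact: measurable_funS (measurable_closed_eball r) sub mf.
have mg' : measurable_fun setT (f \_ (closed_eball r)).
  by apply/(measurable_restrictT _ (measurable_closed_eball r)).
have [rho [phi [rho0 phi2pi xE yE]]] :=
  polar_coordinates ((P^T *m q) 0 0) ((P^T *m q) 1 0).
set z := (P^T *m q) ord_max 0.
have qE : q = cylindrical P rho phi z.
  by rewrite /cylindrical -xE -yE -cart_eta mulmxA PP' mul1mx.
have rho2E : rho2 P q = rho ^+ 2.
  by rewrite /rho2 xE yE !exprMn -mulrDr cos2Dsin2 mulr1.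
have cyl_eball t : eball r (cylindrical P rho t z).
  have cylE u : (enorm (cylindrical P rho u z) < r) = (rho ^+ 2 + z ^+ 2 < r ^+ 2).
    rewrite -(@ltr_pXn2r _ 2) ?nnegrE ?enorm_ge0 ?(ltW r0)//.
    by rewrite enorm_cylindrical.
  by move: qr; rewrite /eball/= qE !cylE.
pose h t := (f \_ (eball r)) (cylindrical P rho t z).
have mh : measurable_fun setT (h : RR -> R).
  exact: measurableT_comp mg (measurable_cylindrical P rho z).
have hM t : `|h t| <= M by apply: patch_bounded => // x /sub; exact: fM.
have -> : \int[U]_theta (f \_ (eball r)) (axis_rot P theta *m q) = \int[U]_t h t.
  rewrite -(Rintegral_uniform_shift mh hM _ phi2pi).
    by congr (Rintegral _ _ _); apply/funext => t; rewrite qE axis_rot_cylindrical.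
  by move=> t; rewrite /h cylindrical_periodic.
pose k t := (f \_ (closed_eball r)) (cylindrical P r t 0).
have mk : measurable_fun setT (k : RR -> R).
  exact: measurableT_comp mg' (measurable_cylindrical P r 0).
have kM t : `|k t| <= M by apply: patch_bounded.
rewrite -[circle_mean P r f]/(\int[U]_t k t) -RintegralB//; last 2 first.
- exact: (@probability_integrable _ _ _ U _ M).
- exact: (@probability_integrable _ _ _ U _ M).
have hk t : `|h t - k t| <= e.
  have ct := @cylindrical_closed_eball P r t (ltW r0) PP.
  rewrite /h /k !patchE !mem_set//; apply: fe => //; first exact: sub.
  move=> i; have -> : forall x y : V, x i 0 - y i 0 = (x - y) i 0.
    by move=> x y; rewrite !mxE.
  apply: le_lt_trans (coor_le_enorm _ i) _.
  rewrite -(@ltr_pXn2r _ 2) ?nnegrE ?enorm_ge0 ?(ltW d0)// enorm_cylindricalB//.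
  (* From [z ^+ 2 < r ^+ 2 - rho ^+ 2] the squared distance [(rho - r) ^+ 2 + z ^+ 2] is below
     [2 * r * (r - rho)], hence below [2 * r * eta]. *)
  have rz : rho ^+ 2 + z ^+ 2 < r ^+ 2.
    rewrite -(enorm_cylindrical rho t z PP) ltr_pXn2r ?nnegrE ?enorm_ge0 ?(ltW r0)//.
    exact: cyl_eball.
  have rhoeta : r - eta < rho.
    by move: qrho; rewrite rho2E ltr_pXn2r ?nnegrE// subr_ge0 ltW.
  have : r * (r - eta) < r * rho by rewrite ltr_pM2l.
  by rewrite subr0; nra.
have := @probability_Rintegral_dist _ _ _ U (fun t : RR => h t - k t) (M + M) 0 e set0.
rewrite measure0 /= mulr0 addr0 subr0; apply => //.
- exact: measurable_funB.
- by move=> t; rewrite (le_trans (ler_normB _ _))// lerD.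
- by rewrite normr0 addr_ge0.
- by move=> t _; rewrite subr0.
Qed.

(** Once [f] is replaced by its rotation means, the integrand is within [e] of the circle mean off
    [bad] and within [2 * M] of it elsewhere. The parameters [beta] and [t] enter the bound only
    through the mass of [bad]. *)
Lemma nu_integral_dist (m r : R) (w0 P : 'M[R]_3) (f : V -> R) (M eta d e : R)
    (beta t : R) :
    0 < r -> so3 w0 -> axis_frame w0 P -> 0 < eta < r ->
    0 < d -> 2 * r * eta <= d ^+ 2 -> 0 <= e -> 0 <= M ->
    measurable_fun (closed_eball r) f ->
    (forall q, closed_eball r q -> `|f q| <= M) ->
    (forall x y, closed_eball r x -> closed_eball r y ->
      (forall i, `|x i 0 - y i 0| < d) -> `|f x - f y| <= e) ->
  let N := nu m r beta (t *: w0) in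
  let bad := [set q | rho2 P q <= (r - eta) ^+ 2] in
  (\int[N]_(q in eball r) (f q)%:E)%E \is a fin_num /\
  `|fine (\int[N]_(q in eball r) (f q)%:E)%E - circle_mean P r f|
    <= e + 2 * M * fine (N bad).
Proof.
move=> r0 sw fP etar d0 etad e0 M0 mf fM fe N0 bad; have [PP _] := fP.
pose N : probability V R := HB.pack N0
  (Measure_isProbability.Build _ _ _ N0 (nu_setT m beta (t *: w0) r0)).
have sub : eball r `<=` (closed_eball r : set V) by move=> x; exact: ltW.
have mg : measurable_fun setT (f \_ (eball r)).
  apply/(measurable_restrictT _ (measurable_eball r)).
  exact: measurable_funS (measurable_closed_eball r) sub mf.
have gM : forall q, `|(f \_ (eball r)) q| <= M.
  by apply: patch_bounded => // q /sub; exact: fM.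
have NE : (\int[N0]_(q in eball r) (f q)%:E)%E =
    (\int[N]_q ((f \_ (eball r)) q)%:E)%E.
  rewrite integral_mkcond; apply: eq_integral => q _.
  by rewrite !patchE; case: ifPn.
rewrite NE; split.
  by apply: integrable_fin_num => //; exact: probability_integrable gM.
rewrite -/(Rintegral N setT (f \_ (eball r))).
have rot_nu theta : preserves N (fun q => axis_rot P theta *m q).
  apply: nu_preserves; first exact: axis_rot_orthogonal.
  move=> q; apply/eqP; rewrite -(@eqrXn2 _ 2) ?enorm_ge0//.
  by rewrite !(enorm_so3 _ _ sw fP) rho2_axis_rot.
have [mF ->] := @Rintegral_average R _ V _ RR N U
  (fun theta q => axis_rot P theta *m q) _ _ (measurable_axis_rot P) rot_nu mg gM.
have mbad : measurable bad.
  have -> : bad = rho2 P @^-1` `]-oo, (r - eta) ^+ 2].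
    by apply/seteqP; split => q; rewrite /= in_itv.
  by apply: measurable_preimage => //; exact: measurable_rho2.
have mB : measurable (~` (eball r : set V)).
  by apply: measurableC; exact: measurable_eball.
(* The pointwise estimate needs [q] in the ball; since [nu] is carried by it, adding the complement
   to the exceptional set costs nothing. *)
have Nbad : N (bad `|` ~` eball r) = N0 bad.
  rewrite /= /N0 /nu; congr (integral _ _ _).
  by rewrite setIUl setICl setU0.
rewrite -Nbad; apply: probability_Rintegral_dist => //.
- move=> q; have := @probability_Rintegral_dist _ _ _ U
    (fun theta : RR => (f \_ (eball r)) (axis_rot P theta *m q)) M 0 M set0.
  rewrite measure0 /= mulr0 addr0 subr0; apply => //.
  + apply: measurableT_comp mg _.
    exact: (@measurableT_comp _ _ _ _ _ _
      (fun z : V * RR => axis_rot P z.2 *m z.1) _ (pair q) (measurable_axis_rot P)).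
  + by rewrite normr0.
  + by move=> theta _; rewrite subr0.
- have := @probability_Rintegral_dist _ _ _ U
    (fun theta : RR => (f \_ (closed_eball r)) (cylindrical P r theta 0)) M 0 M set0.
  rewrite measure0 /= mulr0 addr0 subr0; apply => //.
  + apply: measurableT_comp (measurable_cylindrical P r 0).
    by apply/(measurable_restrictT _ (measurable_closed_eball r)).
  + by move=> theta; exact: patch_bounded.
  + by rewrite normr0.
  + by move=> theta _; rewrite subr0; exact: patch_bounded.
- exact: measurableU.
- move=> q /not_orP[/negP]; rewrite -ltNge => qrho /contrapT qr.
  exact: (rotation_mean_near_circle PP etar d0 etad e0 mf fM fe).
Qed.

End concentration_limit.

Theorem theorem4p2 (R : realType) (m r : R) (hm : 0 < m) (hr : 0 < r)
    (f : 'cV[R]_3 -> R) (hf : {within closed_eball r, continuous f})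
    (w0 : 'M[R]_3) (hw0 : so3 w0) (w0_neq0 : w0 != 0)
    (P : 'M[R]_3) (hP : axis_frame w0 P) :
  (fun p : R * 'M[R]_3 => (\int[nu m r p.1 p.2]_(q in eball r) (f q)%:E)%E)
    @ fast_rotation w0 --> great_circle_average P r f.
Proof.
have [PP _] := hP.
have PF := fast_rotation_proper hw0 w0_neq0.
have mf := within_continuous_measurable_col (measurable_closed_eball r) hf.
have [M M0 fM] := bounded_closed_eball hf.
rewrite (great_circle_averageE hr PP (ltW M0) mf fM).
(* Convergence in the extended reals to a finite limit splits into eventual finiteness and
   convergence of the real values. *)
suff key e : 0 < e -> \forall p \near fast_rotation w0,
    (\int[nu m r p.1 p.2]_(q in eball r) (f q)%:E)%E \is a fin_num /\
    `|circle_mean P r f - fine (\int[nu m r p.1 p.2]_(q in eball r) (f q)%:E)%E| <= e.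
  apply/fine_cvgP; split.
    by apply: filterS (key 1 ltr01) => p [].
  apply/cvgrPdist_le => e e0.
  by apply: filterS (key e e0) => p [].
move=> e0; have e20 : 0 < e / 2 by rewrite divr_gt0.
have [d d0 fd] := uniform_continuity_eball hf e20.
(* The first term keeps [eta] below [r], the second gives [2 * r * eta <= d ^+ 2]. *)
pose eta := Num.min (r / 2) (d ^+ 2 / (2 * r)).
have eta0 : 0 < eta.
  by rewrite lt_min !divr_gt0// ?exprn_gt0// mulr_gt0.
have etar : 0 < eta < r.
  by rewrite eta0/= (@le_lt_trans _ _ (r / 2)) ?ge_min ?lexx//; lra.
have etad : 2 * r * eta <= d ^+ 2.
  by rewrite mulrC -ler_pdivlMr ?mulr_gt0// ge_min lexx orbT.
have [C [kappa [C0 kappa0 nubad]]] := nu_inner_cylinder_le hm hr hw0 hP etar.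
(* Chosen so that [2 * M * (C * A^-1) = e / 2]. *)
pose A := 4 * M * C / e.
have A0 : 0 < A by rewrite divr_gt0// !mulr_gt0.
(* Beyond this threshold the exponential is at most [A^-1]. The absolute value makes the threshold
   nonnegative, so that [nubad] applies. *)
exists (`|ln A| / kappa) => // -[beta w] [/= beta0 [t ->]] L.
have L0 : 0 <= beta * so3_inner (t *: w0) (t *: w0).
  by rewrite (le_trans _ (ltW L))// divr_ge0// ltW.
have [Ifin Ia] := nu_integral_dist m beta t hr hw0 hP etar d0 etad (ltW e20) (ltW M0) mf fM
  (fun x y Kx Ky xy => ltW (fd x y Kx Ky xy)).
split => //; rewrite distrC; apply: le_trans Ia _.
rewrite [leRHS]splitr lerD2l.
have nule := nubad beta t L0.
have nufin : nu m r beta (t *: w0) [set q | rho2 P q <= (r - eta) ^+ 2] \is a fin_num.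
  by rewrite ge0_fin_numE// (le_lt_trans nule) ?ltry.
move: nule; rewrite -(fineK nufin) lee_fin => nule.
have expA : expR (- (kappa * (beta * so3_inner (t *: w0) (t *: w0)))) <= A^-1.
  rewrite -[A]lnK ?posrE// -expRN ler_expR lerN2.
  move: L; rewrite ltr_pdivrMr// mulrC => /ltW; apply: le_trans.
  exact: ler_norm.
apply: (@le_trans _ _ (2 * M * (C * A^-1))).
  rewrite ler_pM2l ?mulr_gt0//; apply: le_trans nule _.
  by rewrite ler_pM2l.
rewrite /A le_eqVlt; apply/orP; left; apply/eqP; field.
by rewrite !gt_eqF.
Qed.
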